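(* Let $K$ be a field, $S=K[x_1,\ldots,x_n]$, $I\subset S$ a monomial ideal generated in degree $d$, and $B=G(I)$ its minimal set of monomial generators. Let $<^{\#}$ be a monomial order on $R=K[\{T_u\}_{u\in B}]$ and $<_\sigma$ a monomial order on $S$. If $B$ satisfies the $\sigma$-exchange property with respect to $<^{\#}$, then for every $N\ge 1$ the power $I^N$ has linear quotients with respect to $>_\sigma$; that is, if $G(I^N)=\{w_1,\ldots,w_r\}$ with $w_1>_\sigma\cdots>_\sigma w_r$, then for every $2\le i\le r$ the colon ideal $(w_1,\ldots,w_{i-1}):w_i$ is generated by a subset of the variables $x_1,\ldots,x_n$.
   Context: For a monomial ideal $J$, $G(J)$ denotes its minimal set of monomial generators. For a monomial $w$ of $S$, $\nu_i(w)$ is the exponent of $x_i$ in $w$ and $\operatorname{supp}(w)=\{i:\nu_i(w)>0\}$. $K[B]\subset S$ is the $K$-subalgebra generated by the monomials in $B$, and the toric ideal $J_{K[B]}$ is the kernel of the $K$-algebra map $R\to K[B]$, $T_u\mapsto u$. A monomial of $R$ is a standard monomial of $J_{K[B]}$ with respect to $<^{\#}$ if it does not belong to the initial ideal $\mathrm{in}_{<^{\#}}(J_{K[B]})$. $B$ satisfies the $\sigma$-exchange property with respect to $<^{\#}$ if: whenever $T_{u_1}\cdots T_{u_N}$ and $T_{v_1}\cdots T_{v_N}$ are standard monomials of $J_{K[B]}$ with respect to $<^{\#}$ such that $u_1\cdots u_N<_\sigma v_1\cdots v_N$, there exist $1\le\delta\le N$, $q\in\operatorname{supp}(v_1\cdots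 v_N)$ and $j\in\operatorname{supp}(u_\delta)$ such that (i) $\nu_q(u_1\cdots u_N)<\nu_q(v_1\cdots v_N)$; (ii) $x_j<_\sigma x_q$; (iii) $x_qu_\delta/x_j\in B$. *)

(* Defs.v *)
From mathcomp Require Import all_boot all_order all_algebra.
From mathcomp Require Export mpoly.

Set Implicit Arguments.
Unset Strict Implicit.
Unset Printing Implicit Defensive.

Import GRing.Theory.
Local Open Scope ring_scope.

Section Ideals.
Variables (n : nat) (K : fieldType).
Implicit Types (I J G : {mpoly K[n]} -> Prop) (f g : {mpoly K[n]}).

(* Ideals are Prop-valued predicates: membership need not be decidable, and
   the zero and unit ideals are allowed. *)
Definition eq_ideal I J : Prop := forall f, I f <-> J f.

Definition ideal_gen G f : Prop :=
  exists s : seq ({mpoly K[n]} * {mpoly K[n]}),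
    (forall p, p \in s -> G p.2) /\ f = \sum_(p <- s) p.1 * p.2.

Definition ideal_exp I (N : nat) : {mpoly K[n]} -> Prop :=
  ideal_gen (fun g => exists t : N.-tuple {mpoly K[n]},
    (forall k, I (tnth t k)) /\ g = \prod_(k < N) tnth t k).

Definition colon J g : {mpoly K[n]} -> Prop := fun f => J (f * g).

Definition mon_ideal (M : 'X_{1..n} -> Prop) : {mpoly K[n]} -> Prop :=
  ideal_gen (fun g => exists2 w, M w & g = 'X_[w]).

Definition monomial_ideal I : Prop :=
  exists M : 'X_{1..n} -> Prop, eq_ideal I (mon_ideal M).

Definition generated_in_degree (d : nat) I : Prop :=
  exists G, (forall g, G g -> g \is d.-homog) /\ eq_ideal I (ideal_gen G).

(* [min_mon_gens J B]: the entries of B, listed without repetition, are the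
   elements of G(J). *)
Definition min_mon_gens J (B : seq 'X_{1..n}) : Prop :=
  [/\ uniq B,
      eq_ideal J (mon_ideal (fun w => w \in B))
    & forall C : seq 'X_{1..n}, {subset C <= B} ->
        eq_ideal J (mon_ideal (fun w => w \in C)) -> {subset B <= C}].

End Ideals.

(* [lt u v] is the strict relation u < v on exponent vectors; multiplying
   monomials is adding exponent vectors, and 0%MM is the monomial 1. *)
Definition monomial_order (n : nat) (lt : rel 'X_{1..n}) : Prop :=
  [/\ irreflexive lt,
      transitive lt,
      forall u v, u != v -> lt u v || lt v u,
      forall w, w != 0%MM -> lt 0%MM w
    & forall u v w, lt u v -> lt (u + w)%MM (v + w)%MM].

Section InitialIdeal.
Variables (m : nat) (K : fieldType) (lt : rel 'X_{1..m}).

(* w is the largest monomial of f; in particular f is nonzero. *)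
Definition initial_monomial (f : {mpoly K[m]}) (w : 'X_{1..m}) : Prop :=
  w \in msupp f /\ forall w', w' \in msupp f -> w' != w -> lt w' w.

Definition initial_ideal (J : {mpoly K[m]} -> Prop) : {mpoly K[m]} -> Prop :=
  mon_ideal (fun w => exists2 f, J f & initial_monomial f w).

Definition standard_monomial (J : {mpoly K[m]} -> Prop) (w : 'X_{1..m}) : Prop :=
  ~ initial_ideal J 'X_[w].

End InitialIdeal.

Definition supp (n : nat) (w : 'X_{1..n}) : {set 'I_n} :=
  [set i | (0 < w i)%N].

Section Toric.
Variables (n m : nat) (K : fieldType) (B : m.-tuple 'X_{1..n}).

(* The ring K[T_u : u in B] is {mpoly K[m]}, where 'X_i stands for T_u with
   u = tnth B i.  Since K[B] is a subring of K[x_1, ..., x_n], the kernel can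
   be computed in the latter. *)
Definition toric_ideal (f : {mpoly K[m]}) : Prop :=
  f \mPo [tuple 'X_[K, tnth B i] | i < m] = 0.

(* A product of N generators is given by the tuple of their indices in B:
   T_mon u is T_{u_1} ... T_{u_N} and x_mon u is u_1 ... u_N. *)
Definition T_mon (N : nat) (u : N.-tuple 'I_m) : 'X_{1..m} :=
  (\sum_(k < N) U_(tnth u k))%MM.

Definition x_mon (N : nat) (u : N.-tuple 'I_m) : 'X_{1..n} :=
  (\sum_(k < N) tnth B (tnth u k))%MM.

(* In the last clause the truncated subtraction is exact, as j lies in the
   support of u_delta. *)
Definition sigma_exchange (ltT : rel 'X_{1..m}) (lts : rel 'X_{1..n}) : Prop :=
  forall (N : nat) (u v : N.-tuple 'I_m),
    standard_monomial ltT toric_ideal (T_mon u) ->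
    standard_monomial ltT toric_ideal (T_mon v) ->
    lts (x_mon u) (x_mon v) ->
    exists (delta : 'I_N) (q j : 'I_n),
      let u_delta := tnth B (tnth u delta) in
      [/\ q \in supp (x_mon v),
          j \in supp u_delta,
          (x_mon u q < x_mon v q)%N,
          lts U_(j)%MM U_(q)%MM
        & ((U_(q) + u_delta) - U_(j))%MM \in B].

End Toric.

Arguments sigma_exchange {n m} K B ltT lts.

(* w_i of the mathematical text is nth 0 w (i - 1), and take (i - 1) w lists
   its predecessors; the index i below is the 0-based one. *)
Definition linear_quotients (n : nat) (K : fieldType) (lts : rel 'X_{1..n})
    (J : {mpoly K[n]} -> Prop) : Prop :=
  forall w : seq 'X_{1..n},
    min_mon_gens J w -> sorted (fun a b => lts b a) w ->
    forall i : nat, (0 < i < size w)%N ->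
      exists A : {set 'I_n},
        eq_ideal
          (colon (mon_ideal (fun a => a \in take i w)) 'X_[nth 0%MM w i])
          (ideal_gen (fun g : {mpoly K[n]} => exists2 k, k \in A & g = 'X_k)).

(* Main.v *)
(* The standard monomials of the toric ideal represent every product of N generators:
   among all factorizations, take the one that is smallest in T.  Given such
   factorizations of w_i and of a larger w_k, the exchange property replaces w_i by
   w = x_q w_i / x_j, a product of generators with w >_sigma w_i.  All products of N
   generators have the same degree, so they are exactly the elements of G(I^N); hence w
   precedes w_i.  Moreover w : w_i = x_q, and x_q divides w_k : w_i because w_k has the
   larger exponent at q. *)
Require Import Defs.
From mathcomp Require Import all_boot all_order all_algebra.

Set Implicit Arguments.
Unset Strict Implicit.
Unset Printing Implicit Defensive.

Import GRing.Theory.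
Local Open Scope ring_scope.

(** * Monomial ideals and their minimal generators *)

Section MonomialIdeals.
Variables (n : nat) (K : fieldType).
Implicit Types (G : {mpoly K[n]} -> Prop) (M : 'X_{1..n} -> Prop).

Lemma ideal_gen_mem G (f g : {mpoly K[n]}) : G g -> ideal_gen G (f * g).
Proof.
move=> Gg; exists [:: (f, g)]; split; first by move=> p; rewrite inE => /eqP->.
by rewrite big_seq1.
Qed.

Lemma ideal_gen_sum G (T : eqType) (s : seq T) (F : T -> {mpoly K[n]}) :
  (forall x, x \in s -> ideal_gen G (F x)) -> ideal_gen G (\sum_(x <- s) F x).
Proof.
move=> sG; rewrite big_seq; apply: big_ind => //.
  by exists [::]; rewrite big_nil.
move=> f g [s1 [G1 ->]] [s2 [G2 ->]]; exists (s1 ++ s2).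
split; last by rewrite big_cat.
by move=> p; rewrite mem_cat => /orP[/G1|/G2].
Qed.

Lemma msupp_ideal_gen G (f : {mpoly K[n]}) w : ideal_gen G f -> w \in msupp f ->
  exists g a b, [/\ G g, b \in msupp g & w = (a + b)%MM].
Proof.
move=> [s [Gs ->]] /msupp_sum_le /flattenP[_ /mapP[p + ->]].
rewrite filter_predT => ps /msuppM_le /allpairsP[[a b] /= [_ bp ->]].
by exists p.2, a, b; split=> //; apply: Gs.
Qed.

(** Each monomial of a combination of generators is a multiple of a generator; conversely, [f] is
    the sum of its terms. *)
Lemma mon_idealP M (f : {mpoly K[n]}) :
  mon_ideal M f <-> forall w, w \in msupp f -> exists2 u, M u & (u <= w)%MM.
Proof.
split=> [If w /(msupp_ideal_gen If)[_ [a [b [[u Mu ->] + ->]]]]|Mf].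
  by rewrite msuppX inE => /eqP->; exists u => //; apply: lem_addl.
rewrite [f]mpolyE; apply: ideal_gen_sum => w /Mf[u Mu le_uw].
rewrite -(submK le_uw) mpolyXD scalerAl.
by apply: ideal_gen_mem; exists u.
Qed.

Lemma mon_idealXP M w :
  mon_ideal M ('X_[w] : {mpoly K[n]}) <-> exists2 u, M u & (u <= w)%MM.
Proof.
split=> [/mon_idealP|Mw]; first by apply; rewrite msuppX inE.
by apply/mon_idealP => w'; rewrite msuppX inE => /eqP->.
Qed.

Lemma colon_mon_idealP M w (f : {mpoly K[n]}) : colon (mon_ideal M) 'X_[w] f <->
  forall b, b \in msupp f -> exists2 u, M u & (u <= w + b)%MM.
Proof.
split=> [/mon_idealP Mf b fb|Mf].
  by apply: Mf; rewrite (perm_mem (msuppMX _ _)); apply: map_f.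
by apply/mon_idealP => w'; rewrite (perm_mem (msuppMX _ _)) => /mapP[b fb ->]; apply: Mf.
Qed.

(** Were [a] a proper divisor of [b], the list [B] without [b] would still generate [J], against
    minimality. *)
Lemma min_mon_gens_antichain (J : {mpoly K[n]} -> Prop) (B : seq 'X_{1..n}) :
  min_mon_gens J B -> {in B &, forall a b, (a <= b)%MM -> a = b}.
Proof.
move=> [_ JB Bmin] a b Ba Bb le_ab; apply/eqP/contraT => ne_ab.
have sub : {subset rem b B <= B} by apply: mem_rem.
have remB c : c \in B -> c != b -> c \in rem b B.
  by move=> Bc ne_cb; move: Bc; rewrite (perm_mem (perm_to_rem Bb)) inE (negPf ne_cb).
have: b \in filter (predC1 b) B; last by rewrite mem_filter /= eqxx.
apply: Bmin => // [c|f]; first by rewrite mem_filter => /andP[].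
split=> [/JB/mon_idealP fB|/mon_idealP fB].
  apply/mon_idealP => w /fB[c Bc le_cw].
  case: (eqVneq c b) => [eq_cb|ne_cb]; last first.
    by exists c => //; rewrite mem_filter /= ne_cb.
  exists a; first by rewrite mem_filter /= ne_ab.
  by apply: lepm_trans le_cw; rewrite eq_cb.
apply/JB/mon_idealP => w /fB[c + le_cw]; rewrite mem_filter => /andP[_ Bc].
by exists c.
Qed.

(** [w] is a multiple of some [u] in [M], itself a multiple of some [b] in [B]; the antichain
    property forces [b = w], hence [u = w]. *)
Lemma min_mon_gens_sub M (J : {mpoly K[n]} -> Prop) (B : seq 'X_{1..n}) w :
  min_mon_gens J B -> eq_ideal J (mon_ideal M) -> w \in B -> M w.
Proof.
move=> mB JM Bw; have [_ JB _] := mB.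
have /JB/JM/mon_idealXP[u Mu le_uw]: mon_ideal (fun w => w \in B) ('X_[w] : {mpoly K[n]}).
  by apply/mon_idealXP; exists w => //; apply: lepm_refl.
have /JM/JB/mon_idealXP[b Bb le_bu]: mon_ideal M ('X_[u] : {mpoly K[n]}).
  by apply/mon_idealXP; exists u => //; apply: lepm_refl.
have eq_bw : b = w.
  by apply: (min_mon_gens_antichain mB) => //; apply: lepm_trans le_uw.
rewrite (_ : w = u) //; apply/mnmP => i; apply/eqP; rewrite eqn_leq.
by rewrite (mnm_lepP le_uw) -eq_bw (mnm_lepP le_bu).
Qed.

Lemma min_mon_gens_homog (I : {mpoly K[n]} -> Prop) (B : seq 'X_{1..n}) d :
  min_mon_gens I B -> generated_in_degree d I -> {in B, forall b, mdeg b = d}.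
Proof.
move=> mB [G [Gd IG]] b Bb.
(* The degree-[d] generators in [G] may fail to be monomials, so the generating set taken is that of
   the degree-[d] monomials occurring in elements of [I]. *)
have IM : eq_ideal I (mon_ideal (fun w =>
    exists2 g, ideal_gen G g & w \in msupp g /\ mdeg w = d)).
  have [_ IB _] := mB.
  move=> f; split=> [/IG If|/mon_idealP If].
    apply/mon_idealP => w /(msupp_ideal_gen If)[g [a [c [Gg gc ->]]]].
    exists c; last exact: lem_addl.
    exists g; first by rewrite -[g]mul1r; apply: ideal_gen_mem.
    by split=> //; apply: (dhomogP _ _ _ (Gd _ Gg)).
  apply/IB/mon_idealP => w /If[u [g /IG/IB/mon_idealP Ig [gu _]] le_uw].
  by have [c Bc le_cu] := Ig u gu; exists c => //; apply: lepm_trans le_uw.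
by have [g _ []] := min_mon_gens_sub mB IM Bb.
Qed.

Lemma msupp_prod (N : nat) (F : 'I_N -> {mpoly K[n]}) w :
  w \in msupp (\prod_(k < N) F k) ->
  exists2 g : 'I_N -> 'X_{1..n},
    forall k, g k \in msupp (F k) & w = (\sum_(k < N) g k)%MM.
Proof.
elim: N F w => [|N IHN] F w.
  rewrite big_ord0 msupp1 inE => /eqP->.
  by exists (fun=> 0%MM) => [[]//|]; rewrite big_ord0.
rewrite big_ord_recl => /msuppM_le/allpairsP[[a b] /= [Fa /IHN[g gF ->] ->]].
exists (fun k => oapp g a (unlift ord0 k)) => [k|].
  by case: unliftP => [j|] -> //=.
by rewrite big_ord_recl unlift_none /=; under [in RHS]eq_bigr do rewrite liftK.
Qed.

End MonomialIdeals.

(** * Generators of the powers of [I] *)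

Section Powers.
Variables (n m : nat) (K : fieldType) (B : m.-tuple 'X_{1..n}).

(** A monomial of a product of [N] elements of [I] is a product of [N] monomials, each divisible by
    an entry of [B]. *)
Lemma ideal_exp_mon (I : {mpoly K[n]} -> Prop) (N : nat) :
  eq_ideal I (mon_ideal (fun w => w \in B)) ->
  eq_ideal (ideal_exp I N)
           (mon_ideal (fun w => exists u : N.-tuple 'I_m, w = x_mon B u)).
Proof.
move=> IB f; split=> [If|/mon_idealP If].
  apply/mon_idealP => w /(msupp_ideal_gen If)[_ [a [b [[t [tI ->]] + ->]]]].
  move=> /msupp_prod[g gt ->].
  have /fin_all_exists[u uP] k : exists i : 'I_m, (tnth B i <= g k)%MM.
    have /IB/mon_idealP/(_ _ (gt k))[c /tnthP[i ->]] := tI k.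
    by exists i.
  exists (x_mon B [tuple u k | k < N]); first by exists [tuple u k | k < N].
  apply: lepm_trans (lem_addl _ _); apply/mnm_lepP => i.
  by rewrite !mnm_sumE leq_sum // => k _; rewrite tnth_mktuple; apply/mnm_lepP.
rewrite [f]mpolyE; apply: ideal_gen_sum => w /If[_ [u ->] le_uw].
rewrite -(submK le_uw) mpolyXD scalerAl; apply: ideal_gen_mem.
exists [tuple 'X_[tnth B (tnth u k)] | k < N]; split.
  move=> k; rewrite tnth_mktuple; apply/IB/mon_idealXP.
  by exists (tnth B (tnth u k)); [apply: mem_tnth | apply: lepm_refl].
by rewrite -mprodXE; apply: eq_bigr => k _; rewrite tnth_mktuple.
Qed.

Lemma mdeg_x_mon d N (u : N.-tuple 'I_m) :
  {in B, forall b, mdeg b = d} -> mdeg (x_mon B u) = (N * d)%N.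
Proof.
move=> Bd; rewrite mdeg_sum (eq_bigr (fun=> d)) => [|k _].
  by rewrite sum_nat_const card_ord.
by rewrite Bd // mem_tnth.
Qed.

(** All products of [N] entries of [B] have degree [N * d], so none properly divides another and all
    are minimal generators. *)
Lemma min_mon_gens_exp (I : {mpoly K[n]} -> Prop) (w : seq 'X_{1..n}) d N :
  {in B, forall b, mdeg b = d} -> eq_ideal I (mon_ideal (fun w => w \in B)) ->
  min_mon_gens (ideal_exp I N) w ->
  forall a, a \in w <-> exists u : N.-tuple 'I_m, a = x_mon B u.
Proof.
move=> Bd IB mw a; have IN := ideal_exp_mon N IB.
have sub := min_mon_gens_sub mw IN.
split=> [/sub//|[u ->]]; have [_ Iw _] := mw.
have /IN/Iw/mon_idealXP[c wc le_cu]: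
    mon_ideal (fun w => exists u : N.-tuple 'I_m, w = x_mon B u)
      ('X_[x_mon B u] : {mpoly K[n]}).
  by apply/mon_idealXP; exists (x_mon B u); [exists u | apply: lepm_refl].
have [v c_v] := sub _ wc.
suff -> : x_mon B u = c by [].
rewrite -(submK le_cu) (_ : (_ - c)%MM = 0%MM) ?add0m //; apply/eqP.
rewrite -mdeg_eq0 -(eqn_add2r (mdeg c)) -mdegD submK // add0n c_v.
by rewrite !(mdeg_x_mon _ Bd).
Qed.

(** * The toric map and standard representatives *)

Lemma ex_T_mon N (w : 'X_{1..m}) : mdeg w = N -> exists u : N.-tuple 'I_m, T_mon u = w.
Proof.
elim: N w => [|N IHN] w dw.
  exists [tuple]; rewrite /T_mon big_ord0; apply/esym/eqP.
  by rewrite -mdeg_eq0 dw.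
have [i wi]: exists i, w i != 0%N.
  apply/existsP/contraT; rewrite negb_exists => /forallP w0.
  move: dw; rewrite mdegE big1 // => i _; exact/eqP/negPn/w0.
have le_iw : (U_(i) <= w)%MM by rewrite lep1mP.
have [|u Tu] := IHN (w - U_(i))%MM.
  by apply/eqP; rewrite -eqSS -dw -[in X in _ == X](submK le_iw) mdegD mdeg1 addn1.
exists [tuple of i :: u]; rewrite /T_mon big_ord_recl tnth0.
under eq_bigr do rewrite tnthS.
by rewrite -/(T_mon u) Tu addmC submK.
Qed.

(** The map [T_u |-> u] sends the T-monomial with exponent vector [w] to the monomial of [S] with
    this exponent vector. *)
Definition toric_exponent (w : 'X_{1..m}) : 'X_{1..n} :=
  (\sum_(i < m) tnth B i *+ w i)%MM.

Lemma toric_exponentD w1 w2 :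
  toric_exponent (w1 + w2)%MM = (toric_exponent w1 + toric_exponent w2)%MM.
Proof.
rewrite -big_split; apply: eq_bigr => i _ /=.
by apply/mnmP => j; rewrite !(mulmnE, mnmDE) mulnDr.
Qed.

Lemma toric_exponentU i : toric_exponent U_(i)%MM = tnth B i.
Proof.
rewrite /toric_exponent (bigD1 i) //= big1 ?addm0 => [|j ne_ji].
  by rewrite mnm1E eqxx /= mulm1n.
by rewrite mnm1E eq_sym (negPf ne_ji) mulm0n.
Qed.

Lemma toric_exponent_T_mon N (u : N.-tuple 'I_m) : toric_exponent (T_mon u) = x_mon B u.
Proof.
rewrite (big_morph toric_exponent (id1 := 0%MM) (op1 := +%MM)).
- by apply: eq_bigr => k _; apply: toric_exponentU.
- exact: toric_exponentD.
- by rewrite /toric_exponent big1 // => i _; rewrite mnm0E mulm0n.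
Qed.

Lemma mdeg_toric_exponent d w :
  {in B, forall b, mdeg b = d} -> mdeg (toric_exponent w) = (mdeg w * d)%N.
Proof.
move=> Bd; rewrite mdeg_sum mdegE big_distrl /=; apply: eq_bigr => i _.
by rewrite mdegMn Bd ?mem_tnth // mulnC.
Qed.

(* The monomial of f at w has to be cancelled in the image of f. *)
Lemma toric_ideal_cancel (f : {mpoly K[m]}) w : toric_ideal B f -> w \in msupp f ->
  exists w', [/\ w' \in msupp f, w' != w & toric_exponent w' = toric_exponent w].
Proof.
move=> f0 fw.
have [/hasP[w' fw' /andP[ne /eqP eqe]]|/hasPn none] :=
  boolP (has (fun w' => (w' != w) && (toric_exponent w' == toric_exponent w)) (msupp f)).
  by exists w'.
(* No other term of [f] lands on this monomial, so its coefficient in the image is that of [f] at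
   [w], which is nonzero. *)
have: (f \mPo [tuple 'X_[K, tnth B i] | i < m])@_(toric_exponent w) = f@_w.
  rewrite comp_mpolyEX raddf_sum /= (bigD1_seq w) ?msupp_uniq //= big_seq_cond big1.
    rewrite addr0 mcoeffZ comp_mpolyX.
    under eq_bigr do rewrite tnth_mktuple mpolyXn.
    by rewrite mprodXE mcoeffX eqxx mulr1.
  move=> w' /andP[/none + ne]; rewrite ne /= => /negPf ne'.
  rewrite mcoeffZ comp_mpolyX.
  under eq_bigr do rewrite tnth_mktuple mpolyXn.
  by rewrite mprodXE mcoeffX ne' mulr0.
by rewrite f0 mcoeff0 => /esym/eqP; rewrite mcoeff_eq0 fw.
Qed.

(* The representative is the ltT-smallest T-monomial in the fiber.  Positivity of d keeps
   the fiber in one degree, hence within the N-tuples. *)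
Lemma ex_standard_rep d N (ltT : rel 'X_{1..m}) (u : N.-tuple 'I_m) :
  monomial_order ltT -> (0 < d)%N -> {in B, forall b, mdeg b = d} ->
  exists2 v : N.-tuple 'I_m,
    x_mon B v = x_mon B u & standard_monomial ltT (@toric_ideal n m K B) (T_mon v).
Proof.
move=> [irr tr _ _ ltD] d_gt0 Bd.
(* The order is turned into a count: among the finitely many [N]-tuples of the fiber, fewest tuples
   below means smallest T-monomial. *)
pose below (v : N.-tuple 'I_m) := [set v' : N.-tuple 'I_m | ltT (T_mon v') (T_mon v)].
have [v /eqP eq_vu vmin] :=
  @arg_minnP _ u (fun v => x_mon B v == x_mon B u) (fun v => #|below v|) (eqxx _).
(* Otherwise an initial monomial [w] divides [T_mon v]; replacing it by a smaller [w'] with the same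
   image contradicts minimality. *)
exists v => // /mon_idealXP[w [f f0 [fw wmax]] le_wv].
have [w' [fw' ne_w'w eq_w'w]] := toric_ideal_cancel f0 fw.
have dw : mdeg w' = mdeg w.
  apply/eqP; rewrite -(eqn_pmul2r d_gt0).
  by rewrite -!(mdeg_toric_exponent _ Bd) eq_w'w.
have [|v' Tv'] := ex_T_mon (N := N) (w := ((T_mon v - w) + w')%MM).
  rewrite mdegD dw -mdegD submK // mdeg_sum.
  by under eq_bigr do rewrite mdeg1; rewrite sum_nat_const card_ord muln1.
have lt_v'v : ltT (T_mon v') (T_mon v).
  by rewrite Tv' -[X in ltT _ X](submK le_wv) ![(_ - w + _)%MM]addmC; apply/ltD/wmax.
have /vmin: x_mon B v' == x_mon B u.
  rewrite -eq_vu -!toric_exponent_T_mon Tv' toric_exponentD eq_w'w.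
  by rewrite -toric_exponentD submK.
(* [below v'] lies strictly inside [below v]: only the latter contains [v']. *)
apply/negP; rewrite -ltnNge; apply: proper_card; apply/properP; split.
  by apply/subsetP => z; rewrite !inE => /tr; apply.
by exists v'; rewrite !inE ?irr.
Qed.

(** [x_j] divides the [k]-th factor, so the whole product can be divided by [x_j] there; [u'] puts
    the exchanged generator in that place. *)
Lemma x_mon_exchange N (u : N.-tuple 'I_m) (k : 'I_N) (q j : 'I_n) :
  j \in supp (tnth B (tnth u k)) ->
  ((U_(q) + tnth B (tnth u k)) - U_(j))%MM \in B ->
  (U_(j) <= x_mon B u)%MM /\
  exists u' : N.-tuple 'I_m, x_mon B u' = (U_(q) + (x_mon B u - U_(j)))%MM.
Proof.
rewrite inE => uj /tnthP[l Bl].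
have le_j : (U_(j) <= tnth B (tnth u k))%MM by rewrite lep1mP -lt0n.
have x_uE : x_mon B u =
    (tnth B (tnth u k) + \sum_(i < N | i != k) tnth B (tnth u i))%MM.
  by rewrite /x_mon (bigD1 k).
have le_ju : (U_(j) <= x_mon B u)%MM by rewrite x_uE; apply: lepm_trans (lem_addr _ _).
split=> //; exists [tuple if i == k then l else tnth u i | i < N].
rewrite /x_mon (bigD1 k) //= tnth_mktuple eqxx -Bl.
under eq_bigr => i /negPf ne_ik do rewrite tnth_mktuple ne_ik.
rewrite -/(x_mon B u) x_uE -addmBA // -addmA; congr (_ + _)%MM.
by rewrite ![(_ + \sum_(_ < _ | _) _)%MM]addmC addmBA.
Qed.

End Powers.

Theorem theorem3p6 (K : fieldType) (n d m : nat)
    (I : {mpoly K[n]} -> Prop) (B : m.-tuple 'X_{1..n})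
    (ltT : rel 'X_{1..m}) (lts : rel 'X_{1..n})
    (hI : monomial_ideal I)
    (hd : generated_in_degree d I)
    (hB : min_mon_gens I B)
    (hltT : monomial_order ltT)
    (hlts : monomial_order lts)
    (hex : sigma_exchange K B ltT lts) :
  forall N : nat, (1 <= N)%N -> linear_quotients lts (ideal_exp I N).
Proof.
move=> N _ w mw ws i /andP[_ lt_iw].
have Bd := min_mon_gens_homog hB hd.
have [_ IB _] := hB; have [irr tr _ _ ltD] := hlts.
have wE := min_mon_gens_exp Bd IB mw.
set wi := nth 0%MM w i.
have tr' : transitive (fun a b => lts b a) by move=> y x z xy yz; apply: tr xy.
have [u wi_u] : exists u : N.-tuple 'I_m, wi = x_mon B u by apply/wE/mem_nth.
(* Since [w] is decreasing, [lt_take] and [take_lt] identify [take i w] with the entries of [w]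
   larger than [wi]. *)
have lt_take a : a \in take i w -> lts wi a.
  move=> wa; have sz := wa; rewrite -index_mem size_take lt_iw in sz.
  have lt_aw := ltn_trans sz lt_iw.
  rewrite -(nth_index 0%MM wa) nth_take //.
  exact: (sorted_ltn_nth tr' 0%MM ws).
have take_lt a : a \in w -> lts wi a -> a \in take i w.
  move=> wa lt_a; rewrite in_take // ltnNge; apply/negP => le_ia.
  have: lts wi wi; last by rewrite irr.
  move: le_ia; rewrite leq_eqVlt => /predU1P[ia|lt_ia].
    by move: lt_a; rewrite -{1}(nth_index 0%MM wa) -ia.
  apply: tr lt_a _; rewrite -{1}(nth_index 0%MM wa).
  by apply: (sorted_ltn_nth tr' 0%MM ws) => //; rewrite inE index_mem.
(* These are exactly the variables lying in the colon ideal. *)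
pose A := [set k : 'I_n | has (fun a => (a <= wi + U_(k))%MM) (take i w)].
exists A => f.
have idA : ideal_gen (fun g : {mpoly K[n]} => exists2 k, k \in A & g = 'X_k) f <->
    mon_ideal (fun a => exists2 k, k \in A & a = U_(k)%MM) f.
  split=> -[s [sA ->]]; exists s; split=> // p /sA.
    by move=> [k Ak ->]; exists U_(k)%MM => //; exists k.
  by move=> [_ [k Ak ->] ->]; exists k.
split=> [/colon_mon_idealP fw|/idA/mon_idealP fA].
  apply/idA/mon_idealP => b /fw[a wa le_a].
  have lt_a := lt_take a wa.
  have [v a_v]: exists v : N.-tuple 'I_m, a = x_mon B v by apply/wE/(mem_take wa).
  (* If [d] were 0, both [a] and [wi] would be the monomial 1, against [lt_a]. *)
  have d_gt0 : (0 < d)%N.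
    rewrite lt0n; apply/eqP => d0; move: lt_a; rewrite wi_u a_v.
    have x0 (z : N.-tuple 'I_m) : x_mon B z = 0%MM.
      by apply/eqP; rewrite -mdeg_eq0 (mdeg_x_mon z Bd) d0 muln0.
    by rewrite !x0 irr.
  have [u' u'u su'] := ex_standard_rep K u hltT d_gt0 Bd.
  have [v' v'v sv'] := ex_standard_rep K v hltT d_gt0 Bd.
  have := hex _ _ _ su' sv'; rewrite u'u v'v -wi_u -a_v.
  move=> /(_ lt_a)[k [q [j /= [_ uj lt_q lt_jq Bq]]]].
  have [le_j [u2 xu2]] := x_mon_exchange uj Bq.
  rewrite u'u -wi_u in le_j xu2.
  (* [wi q < a q <= wi q + b q], so [b q] is positive. *)
  have bq : (U_(q) <= b)%MM.
    rewrite lep1mP -lt0n; have := mnm_lepP le_a q; rewrite mnmDE => le_aq.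
    by have := leq_trans lt_q le_aq; rewrite -{1}[wi q]addn0 ltn_add2l.
  exists U_(q)%MM => //; exists q => //; rewrite inE; apply/hasP.
  (* This monomial exceeds [wi] because [x_j] is smaller than [x_q], and it divides [x_q wi]. *)
  exists (U_(q) + (wi - U_(j)))%MM.
    apply: take_lt; first by apply/wE; exists u2.
    by rewrite -{1}(submK le_j) [(_ + U_(j))%MM]addmC; apply: ltD.
  apply/mnm_lepP => l; rewrite !mnmDE addnC leq_add2r.
  by rewrite mnmBE leq_subr.
(* Conversely, [a] divides [wi x_k] and [x_k] divides [b], so [a] divides [wi b]. *)
apply/colon_mon_idealP => b /fA[_ [k + ->] le_kb]; rewrite inE => /hasP[a wa le_a].
exists a => //; apply: lepm_trans le_a _; apply/mnm_lepP => l.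
by rewrite !mnmDE leq_add2l; apply/mnm_lepP.
Qed.
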